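(* Well-approximated irrational numbers are generic in the sense of Baire category, i.e. the set of well-approximated irrational numbers contains a dense $G_\delta$ subset of $\mathbb{R}$.
   Context: Let $r=[c_0;c_1,c_2,\ldots]$ be an irrational number written as its continued fraction, and $p_k/q_k=[c_0;c_1,\ldots,c_k]$ its $k$-th convergent (in lowest terms, $q_k>0$). The number $r$ is well-approximated if there exists an increasing sequence $\{k_n\}$ of natural numbers such that for any constant $C>0$ we have $\exp(Cq_{k_n})/q_{k_n+1}\to0$ as $n\to\infty$. *)

(* Defs.v *)
From mathcomp Require Import all_boot all_order all_algebra.
From mathcomp Require Import all_classical all_reals all_analysis.
From mathcomp Require Import borel_hierarchy.

Set Implicit Arguments.
Unset Strict Implicit.
Unset Printing Implicit Defensive.

Import Order.TTheory GRing.Theory Num.Theory.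
Import numFieldNormedType.Exports.

Local Open Scope classical_set_scope.
Local Open Scope ring_scope.

(* Complete quotients x_0 = r, x_(k+1) = 1 / (x_k - floor x_k). The expansion
   is infinite exactly when r is irrational; for rational r the values past the
   end of the expansion (where 0^-1 = 0) are meaningless. *)
Fixpoint complete_quotient (R : realType) (r : R) (k : nat) : R :=
  if k is k'.+1 then
    (complete_quotient r k' - (Num.floor (complete_quotient r k'))%:~R)^-1
  else r.

Definition partial_quotient (R : realType) (r : R) (k : nat) : int :=
  Num.floor (complete_quotient r k).

(* cfrac c k = [c 0; c 1, ..., c k], with k + 1 terms. *)
Fixpoint cfrac (c : nat -> int) (k : nat) : rat :=
  if k is k'.+1 then (c 0%N)%:~R + (cfrac (fun i => c i.+1) k')^-1
  else (c 0%N)%:~R.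

Definition convergent (R : realType) (r : R) (k : nat) : rat :=
  cfrac (partial_quotient r) k.

(* denq is the positive denominator in lowest terms. *)
Definition convergent_den (R : realType) (r : R) (k : nat) : int :=
  denq (convergent r k).

Definition well_approximated (R : realType) : set R :=
  [set r | irrational r /\
    exists2 k : nat -> nat, increasing_seq k &
      forall C : R, 0 < C ->
        expR (C * (convergent_den r (k n))%:~R)
          / (convergent_den r (k n).+1)%:~R @[n --> \oo] --> (0 : R)].
Arguments well_approximated : clear implicits.

(* Main.v *)
Require Import Defs.
From mathcomp Require Import all_boot all_order all_algebra.
From mathcomp Require Import all_classical all_reals all_analysis.
From mathcomp Require Import borel_hierarchy.
From mathcomp Require Import ring lra zify.

Set Implicit Arguments.
Unset Strict Implicit.
Unset Printing Implicit Defensive.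

Import Order.TTheory GRing.Theory Num.Theory.
Import numFieldNormedType.Exports.
Local Open Scope classical_set_scope.
Local Open Scope ring_scope.

(* Let U_N be the open set of reals r having a rational p/q with q > N and
   |q r - p| < exp(-N q)/2. It contains every rational (p/q need not be
   reduced), hence is dense, so by Baire the irrationals lying in all the U_N
   form a dense G_delta set. For such an r and such p/q, take k with
   q_k <= q < q_(k+1): the best approximation property of convergents gives
     1 / (2 q_(k+1)) <= |q_k r - p_k| <= |q r - p| < exp(-N q_k)/2,
   whence q_(k+1) > exp(N q_k). *)

(** * Integer numerators and denominators of finite continued fractions *)

Fixpoint cfrac_pair (c : nat -> int) (k : nat) : int * int :=
  if k is k'.+1 then
    let nd := cfrac_pair (fun i => c i.+1) k' in (c 0%N * nd.1 + nd.2, nd.1)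
  else (c 0%N, 1).

Notation cfrac_num c k := (cfrac_pair c k).1.
Notation cfrac_den c k := (cfrac_pair c k).2.

(** Prepending a term applies a matrix of determinant -1, which reduces the claim to the tail of the
    sequence. *)
Lemma cfrac_pair_det (c : nat -> int) (k : nat) :
  cfrac_num c k.+1 * cfrac_den c k - cfrac_den c k.+1 * cfrac_num c k
    = (-1) ^+ k.
Proof.
elim: k c => [|k IHk] c; first by rewrite /=; ring.
by rewrite exprS -(IHk (fun i => c i.+1)) /=; ring.
Qed.

(** The denominator of a continued fraction is the numerator of its tail, so this yields the bounds
    on denominators below, where [c 0] may be any integer. *)
Lemma cfrac_num_ge (c : nat -> int) (k : nat) :
  (forall i, 1 <= c i) ->
  k.+1%:Z <= cfrac_num c k /\ 1 <= cfrac_den c k.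
Proof.
elim: k c => [|k IHk] c c1; first by split; [exact: c1|].
have [n1 d1] := IHk _ (fun i => c1 i.+1).
by move: (c1 0%N) => c01 /=; split; nia.
Qed.

Lemma cfrac_pair_nondecreasing (c : nat -> int) (k : nat) :
  (forall i, 1 <= c i) ->
  cfrac_num c k <= cfrac_num c k.+1 /\ cfrac_den c k <= cfrac_den c k.+1.
Proof.
elim: k c => [|k IHk] c c1.
  by move: (c1 0%N) (c1 1%N) => c01 c11 /=; split; nia.
have [n1 d1] := IHk _ (fun i => c1 i.+1).
by move: n1 d1 (c1 0%N) => /= n1 d1 c01; split; nia.
Qed.

Lemma cfrac_den_ge (c : nat -> int) (k : nat) :
  (forall i, 1 <= c i.+1) -> k%:Z <= cfrac_den c k.
Proof. by case: k => [|k] c1 //; have [] := @cfrac_num_ge _ k c1. Qed.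

Lemma cfrac_den_ge1 (c : nat -> int) (k : nat) :
  (forall i, 1 <= c i.+1) -> 1 <= cfrac_den c k.
Proof.
by case: k => [|k] c1 //; have [/= ? _] := @cfrac_num_ge _ k c1; lia.
Qed.

Lemma cfrac_den_leS (c : nat -> int) (k : nat) :
  (forall i, 1 <= c i.+1) -> cfrac_den c k <= cfrac_den c k.+1.
Proof.
case: k => [|k] c1; first exact: (c1 0%N).
by have [] := @cfrac_pair_nondecreasing _ k c1.
Qed.

Lemma cfracE (c : nat -> int) (k : nat) : (forall i, 1 <= c i.+1) ->
  cfrac c k = (cfrac_num c k)%:~R / (cfrac_den c k)%:~R.
Proof.
elim: k c => [|k IHk] c c1 /=; first by rewrite divr1.
rewrite IHk // invf_div intrD intrM mulrDl mulfK // intr_eq0.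
by have [? _] := @cfrac_num_ge _ k c1; apply/eqP; lia.
Qed.

Lemma denq_cfrac (c : nat -> int) (k : nat) : (forall i, 1 <= c i.+1) ->
  denq (cfrac c k) = cfrac_den c k.
Proof.
move=> c1; have d_ge1 := cfrac_den_ge1 k c1.
rewrite cfracE // coprimeq_den.
  by rewrite gt_eqF ?ger0_norm //; lia.
have := cfrac_pair_det c k.
move: (cfrac_num c k) (cfrac_den c k) (cfrac_num c k.+1) (cfrac_den c k.+1).
move=> n d n1 d1 det; rewrite -/(coprimez n d); apply/coprimezP.
(* Bézout coefficients: the determinant identity multiplied by its own sign. *)
exists (- (-1) ^+ k * d1, (-1) ^+ k * n1).
rewrite /= -[RHS](sqrr_sign int k) -det; ring.
Qed.

(** * Complete quotients and errors of the convergents *)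

Section complete_quotients.
Context {R : realType}.
Implicit Types (r : R) (k : nat).

Lemma complete_quotientS r k :
  complete_quotient r k.+1 =
  complete_quotient (complete_quotient r 1) k.
Proof. by elim: k => [//|k /= <-]. Qed.

Lemma partial_quotientS r k :
  partial_quotient r k.+1 = partial_quotient (complete_quotient r 1) k.
Proof. by rewrite /partial_quotient complete_quotientS. Qed.

Lemma irrational_frac_part r : irrational r ->
  0 < r - (Num.floor r)%:~R < 1.
Proof.
move=> rI; have /andP[r1 r2] := floor_itv r.
rewrite intrD in r2; rewrite subr_gt0 lt_neqAle r1 andbT ltrBlDl r2 andbT.
apply/eqP => rE; apply: rI; exists (Num.floor r)%:~R => //.
by rewrite ratr_int.
Qed.

Lemma irrational_complete_quotient r k :
  irrational r -> irrational (complete_quotient r k).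
Proof.
move=> rI; elim: k => [//|k IHk] [q _ qE]; apply: IHk.
set x := complete_quotient r k in qE *.
exists (q^-1 + (Num.floor x)%:~R) => //.
by rewrite rmorphD /= fmorphV /= ratr_int qE invrK subrK.
Qed.

Lemma complete_quotient_gt1 r k :
  irrational r -> 1 < complete_quotient r k.+1.
Proof.
move=> rI.
have /andP[x0 x1] :=
  irrational_frac_part (irrational_complete_quotient (k := k) rI).
by rewrite /= invf_gt1.
Qed.

Lemma partial_quotient_ge1 r k :
  irrational r -> 1 <= partial_quotient r k.+1.
Proof.
by move=> rI; rewrite /partial_quotient floor_ge_int ltW ?complete_quotient_gt1.
Qed.

(** The error is kept signed because its alternation matters for best approximation. *)
Definition cfrac_err r k : R :=
  (cfrac_den (partial_quotient r) k)%:~R * r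
  - (cfrac_num (partial_quotient r) k)%:~R.

Lemma cfrac_err0 r : cfrac_err r 0 = (complete_quotient r 1)^-1.
Proof. by rewrite /cfrac_err /= invrK mul1r. Qed.

(** With [r = c0 + 1/x], the pair [(n, d)] of the tail becomes [(c0 n + d, n)], and [n r - (c0 n +
    d) = n/x - d = -(d x - n)/x]. *)
Lemma cfrac_err_shift r k : irrational r ->
  cfrac_err r k.+1 =
  - cfrac_err (complete_quotient r 1) k / complete_quotient r 1.
Proof.
move=> rI; have x1 := @complete_quotient_gt1 r 0 rI.
have rE : r = (partial_quotient r 0)%:~R + (complete_quotient r 1)^-1.
  by rewrite /= invrK subrKC.
rewrite /cfrac_err /=.
have -> : (fun i => partial_quotient r i.+1) =
          partial_quotient (complete_quotient r 1).
  by apply/funext => i; rewrite partial_quotientS.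
move: (cfrac_pair _ k) => [n d]; move: x1 rE => /=.
move: (_^-1) (partial_quotient r 0) => x c0 x1 {1}->.
rewrite intrD intrM; field.
by rewrite gt_eqF // (lt_trans _ x1).
Qed.

(** As complete quotients of positive index exceed 1, this makes the errors alternate in sign and
    shrink. The induction shifts both errors to the first complete quotient. *)
Lemma cfrac_errS r k : irrational r ->
  cfrac_err r k.+1 = - cfrac_err r k / complete_quotient r k.+2.
Proof.
elim: k r => [|k IHk] r rI; rewrite cfrac_err_shift //.
  by rewrite !cfrac_err0 (complete_quotientS r 1) !mulNr mulrC.
rewrite IHk; last exact: irrational_complete_quotient.
rewrite (cfrac_err_shift k) // (complete_quotientS r k.+2).
by rewrite !mulNr mulrAC.
Qed.

(** The determinant identity and [cfrac_errS] give [|err_k| (q_(k+1) + q_k / x_(k+2)) = 1], and the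
    bracket is at most [2 q_(k+1)]. *)
Lemma cfrac_err_lower r k : irrational r ->
  1 <= 2 * (cfrac_den (partial_quotient r) k.+1)%:~R * `|cfrac_err r k|.
Proof.
move=> rI; have c1 i := @partial_quotient_ge1 r i rI.
have x1 := @complete_quotient_gt1 r k.+1 rI.
have := cfrac_errS k rI; have := cfrac_den_leS k c1.
have := cfrac_den_ge1 k c1.
have := cfrac_pair_det (partial_quotient r) k.
rewrite /cfrac_err; move: (complete_quotient r k.+2) x1 => x x1.
move: (cfrac_pair _ k) (cfrac_pair _ k.+1) => [n d] [n1 d1] /= det d_ge1 dd1 eS.
have {det} : (d%:~R * r - n%:~R) * (d1%:~R + d%:~R / x) = (-1) ^+ k.
  have <- : n1%:~R * d%:~R - d1%:~R * n%:~R = (-1) ^+ k :> R.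
    by rewrite -!intrM -intrB det rmorphXn rmorphN1.
  have eV : (d%:~R * r - n%:~R) / x = - (d1%:~R * r - n1%:~R).
    by rewrite eS mulNr opprK.
  by rewrite mulrDr (mulrCA _ d%:~R) eV; ring.
move/(congr1 Num.norm); rewrite normrX normrN1 expr1n normrM => det.
rewrite -[leLHS]det mulrC ler_wpM2r // ger0_norm.
  have : d%:~R / x <= d%:~R :> R.
    by rewrite ler_piMr ?ler0z ?invf_le1; lra || lia.
  have : d%:~R <= d1%:~R :> R by rewrite ler_int.
  by lra.
by rewrite addr_ge0 ?divr_ge0 ?ler0z; lra || lia.
Qed.

(* In the lattice basis formed by two consecutive convergents, a vector with
   0 < q < d1 has b = 0 or coordinates a, b of opposite signs; the two errors
   also have opposite signs, so no cancellation takes place. *)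
Lemma cfrac_err_best r k (p q : int) : irrational r ->
  0 < q < cfrac_den (partial_quotient r) k.+1 ->
  `|cfrac_err r k| <= `|q%:~R * r - p%:~R|.
Proof.
move=> rI /andP[q0 qd]; have c1 i := @partial_quotient_ge1 r i rI.
have x1 := @complete_quotient_gt1 r k.+1 rI.
have := cfrac_errS k rI; have := cfrac_den_leS k c1.
have := cfrac_den_ge1 k c1.
have := cfrac_pair_det (partial_quotient r) k; move: qd.
rewrite /cfrac_err; move: (complete_quotient r k.+2) x1 => x x1.
move: (cfrac_pair _ k) (cfrac_pair _ k.+1) => [n d] [n1 d1] /=.
move=> qd det d_ge1 dd1 eS.
have s2 := sqrr_sign int k; rewrite -det expr2 in s2.
set t := n1 * d - d1 * n in s2.
(* Cramer's rule; the determinant [t] is a sign, hence its own inverse, so the coordinates are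
   integers. *)
pose a := t * (q * n1 - p * d1); pose b := t * (p * d - q * n).
have qE : q = a * d + b * d1.
  by rewrite -[LHS]mulr1 -s2 /a /b /t; ring.
have pE : p = a * n + b * n1.
  by rewrite -[LHS]mulr1 -s2 /a /b /t; ring.
clearbody a b; clear s2 t det.
(* Since the next error is [-err_k / x], the error of the vector is [err_k (a - b/x)]; it remains to
   see that the second factor has absolute value at least 1. *)
have -> : q%:~R * r - p%:~R =
          (d%:~R * r - n%:~R) * (a%:~R - b%:~R / x).
  have eV : (d%:~R * r - n%:~R) / x = - (d1%:~R * r - n1%:~R).
    by rewrite eS mulNr opprK.
  by rewrite mulrBr (mulrCA _ b%:~R) eV qE pE !intrD !intrM; ring.
rewrite normrM ler_peMr // ler_normr.
have xV0 : 0 <= x^-1 by rewrite invr_ge0; lra.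
have [b0|b0|b0] := ltgtP b 0.
- have a1 : 1 <= a by nia.
  have : 1 <= a%:~R :> R by rewrite (ler_int _ 1).
  have : b%:~R * x^-1 <= 0 by rewrite mulr_le0_ge0 // lerz0 ltW.
  by move=> ? ?; apply/orP; left; lra.
- have a1 : a <= -1 by nia.
  have : a%:~R <= -1 :> R by rewrite (ler_int _ _ (-1)).
  have : 0 <= b%:~R * x^-1 by rewrite mulr_ge0 // ler0z ltW.
  by move=> ? ?; apply/orP; right; lra.
- have a1 : 1 <= a by nia.
  have : 1 <= a%:~R :> R by rewrite (ler_int _ 1).
  by rewrite b0 mul0r subr0 => ->.
Qed.

(** * Open dense sets of exponentially approximable reals *)

(** The halving cancels the factor 2 in [cfrac_err_lower]. *)
Definition exp_approximable (N : nat) : set R :=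
  \bigcup_(pq in [set pq : int * nat | (N < pq.2)%N])
    [set r | `|pq.2%:R * r - pq.1%:~R| < expR (- (N * pq.2)%:R) / 2].

Lemma open_exp_approximable (N : nat) : open (exp_approximable N).
Proof.
apply: bigcup_open => -[p q] _ /=.
apply: (@open_comp _ _ (fun r : R => `|q%:R * r - p%:~R|)
  [set y | y < expR (- (N * q)%:R) / 2]); last exact: open_lt.
move=> r _; apply: cvg_norm; apply: cvgB; last exact: cvg_cst.
by apply: cvgM; [exact: cvg_cst|exact: cvg_id].
Qed.

Lemma dense_exp_approximable (N : nat) : dense (exp_approximable N).
Proof.
move=> O O0 oO; have [x [Ox [s _ sx]]] := @dense_rat R O O0 oO.
exists x; split => //; rewrite -{}sx.
(* Scaling numerator and denominator by [N + 1] pushes the denominator past [N] while the error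
   stays zero. *)
exists (numq s * N.+1%:Z, (`|denq s| * N.+1)%N) => /=.
  by rewrite -[X in (X < _)%N]/N leq_pmull // absz_gt0 denq_neq0.
have -> : (`|denq s| * N.+1)%:R * ratr s = (numq s * N.+1%:Z)%:~R :> R.
  rewrite natrM natr_absz ger0_norm ?denq_ge0 // intrM mulrAC; congr (_ * _).
  rewrite /ratr mulrCA divff ?mulr1 //.
  by rewrite intr_eq0 denq_neq0.
by rewrite subrr normr0 divr_gt0 ?expR_gt0.
Qed.

Lemma exp_approximable_den r : irrational r ->
  (forall N, exp_approximable N r) ->
  forall N : nat, exists2 k : nat, (N <= k)%N &
    expR (N%:R * (convergent_den r k)%:~R) <= (convergent_den r k.+1)%:~R :> R.
Proof.
move=> rI rA N; have c1 i := @partial_quotient_ge1 r i rI.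
pose d := fun k => cfrac_den (partial_quotient r) k.
have d_ge1 k : 1 <= d k by exact: cfrac_den_ge1.
have d_homo : {homo d : i j / (i <= j)%N >-> i <= j}.
  by apply/nondecreasing_seqP => k; exact: cfrac_den_leS.
(* Of the two bounds in the maximum, [N] controls the exponent, and [d N < q] forces [N <= k]. *)
have [[p q] /= Nq rpq] := rA (maxn N `|d N|).
set M := maxn N `|d N| in Nq rpq.
(* The greatest [k] with [d k <= q] exists: [N] qualifies, and [k <= d k] bounds the candidates. *)
have [k dkq kmax] : exists2 k, d k <= q%:Z & q%:Z < d k.+1.
  have ex : exists k, d k <= q%:Z.
    by exists N; move: (d_ge1 N) Nq; rewrite /M; lia.
  have ub k : d k <= q%:Z -> (k <= q)%N.
    by move=> dk; have := cfrac_den_ge k c1; rewrite -/(d k); lia.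
  case: (ex_maxnP ex ub) => k dk kmax; exists k => //.
  by rewrite ltNge; apply/negP => /kmax; rewrite ltnn.
exists k.
  rewrite leqNgt; apply/negP => kN; have := d_homo _ _ kN.
  by move: (d_ge1 N) Nq; rewrite /M; lia.
rewrite /convergent_den !denq_cfrac // -/(d k) -/(d k.+1).
have q0 : 0 < q%:Z by move: (d_ge1 k); lia.
have best := @cfrac_err_best r k p q rI.
rewrite q0 kmax in best.
have {best} err_lt := le_lt_trans (best isT) rpq.
have low := cfrac_err_lower k rI; rewrite -/(d k.+1) in low.
have d1_gt0 : 0 < (d k.+1)%:~R :> R by rewrite ltr0z; move: (d_ge1 k.+1); lia.
apply: (@le_trans _ _ (expR (M * q)%:R)).
  rewrite ler_expR natrM ler_pM ?ler0z ?ler0n //.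
  - by move: (d_ge1 k); lia.
  - by rewrite ler_nat /M leq_maxl.
  - by rewrite -[q%:R]/(q%:Z%:~R) ler_int.
rewrite expRN in err_lt.
have e0 := expR_gt0 ((M * q)%:R : R).
move: low err_lt; move: (expR _) e0 => e e0 low err_lt.
have : 2 * (d k.+1)%:~R * `|cfrac_err r k| < 2 * (d k.+1)%:~R * (e^-1 / 2).
  by rewrite ltr_pM2l // mulr_gt0.
move=> /(le_lt_trans low).
have -> : 2 * (d k.+1)%:~R * (e^-1 / 2) = (d k.+1)%:~R / e :> R.
  by field; rewrite gt_eqF.
by rewrite ltr_pdivlMr // mul1r => /ltW.
Qed.

Lemma well_approximated_exp_den r : irrational r ->
  (forall N : nat, exists2 k : nat, (N <= k)%N &
    expR (N%:R * (convergent_den r k)%:~R) <= (convergent_den r k.+1)%:~R :> R) ->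
  well_approximated R r.
Proof.
move=> rI ex; split => //.
have /choice[g gP] : forall N : nat, exists k : nat, (N <= k)%N /\
    expR (N%:R * (convergent_den r k)%:~R) <= (convergent_den r k.+1)%:~R :> R.
  by move=> N; have [k] := ex N; exists k.
have gN N := (gP N).1; have {gP}gE N := (gP N).2.
(* Restarting the choice just past the previous index makes [g (h n)] strictly increasing, as
   [h n <= g (h n)]. *)
pose h := fix h n := if n is n'.+1 then (g (h n')).+1 else 0%N.
have hn n : (n <= h n)%N.
  by elim: n => // n IHn /=; rewrite ltnS (leq_trans IHn).
exists (g \o h).
  by apply/increasing_seqP => n; rewrite ltEnat /= (leq_trans _ (gN _)).
move=> C C0.
(* This dominates the quotient: for [n >= C] and [q >= 1], [C q - h n q <= (C - n) q <= C - n]. As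
   [n] outgrows every [C], one sequence serves all constants. *)
have cvgE : expR (C - n%:R) @[n --> \oo] --> (0 : R).
  rewrite -[0](mulr0 (expR C)).
  under eq_fun do rewrite expRD.
  exact: cvgMr (@cvgn_expR R).
apply: (squeeze_cvgr _ (cvg_cst 0) cvgE); near=> n.
have d1 : 1 <= (convergent_den r (g (h n)))%:~R :> R.
  by rewrite (ler_int _ 1) -gtz0_ge1 denq_gt0.
have d1S : 0 < (convergent_den r (g (h n)).+1)%:~R :> R.
  by rewrite ltr0z denq_gt0.
rewrite divr_ge0 ?expR_ge0 ?(ltW d1S) //= ler_pdivrMr //.
apply: (le_trans _ (ler_wpM2l (expR_ge0 _) (gE (h n)))).
rewrite -expRD ler_expR.
have hnn : n%:R <= (h n)%:R :> R by rewrite ler_nat.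
have Cn : C <= n%:R by near: n; exact: nbhs_infty_ger.
by nra.
Unshelve. all: by end_near.
Qed.

End complete_quotients.

(** * The Baire category argument *)

Theorem theoremA1 (R : realType) :
  exists G : set R, [/\ Gdelta G, dense G & G `<=` well_approximated R].
Proof.
have [B oB irrB] := @irrational_Gdelta R.
(* Pairing the two families level by level leaves one sequence of open sets, each dense because two
   open dense sets have a dense intersection. *)
pose F n := B n `&` exp_approximable n.
exists (\bigcap_n F n); split.
- exists F => // n; apply: openI; last exact: open_exp_approximable.
  exact: (oB n).1.
- apply: Baire => n; have [oBn dBn] := oB n; split.
    by apply: openI => //; exact: open_exp_approximable.
  exact: (denseI oBn dBn (dense_exp_approximable n)).
- rewrite bigcapI -irrB => r [rI rA]; apply: well_approximated_exp_den => //.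
  by apply: exp_approximable_den => // N; exact: rA.
Qed.
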